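(* Let $I=(g_1,\dots,g_p)\subset\mathcal{O}_n$ and suppose $f=\sum_{i,j=1}^{p}h_{i,j}g_ig_j$ with $h_{i,j}=h_{j,i}\in\mathcal{O}_n$ and $\det[H(0)]\ne0$, where $[H]$ is the symmetric matrix with entries $h_{i,j}$. Then one can choose a set of generators $(g'_1,\dots,g'_p)$ of $I$ such that $f=\sum_{i=1}^{p}(g'_i)^2$.
   Context: $\mathcal{O}_n$ is the ring of germs at $0$ of holomorphic functions on $\mathbb{C}^n$. *)

(* Defs.v *)
From HB Require Import structures.
From mathcomp Require Import all_boot all_order all_algebra.
From mathcomp Require Import all_classical all_reals all_analysis.
From mathcomp.real_closed Require Import complex.
From mathcomp Require Import ring_quotient.

Set Implicit Arguments.
Unset Strict Implicit.
Unset Printing Implicit Defensive.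

Import Order.TTheory GRing.Theory Num.Theory numFieldNormedType.Exports.

Local Open Scope classical_set_scope.
Local Open Scope ring_scope.
Local Open Scope quotient_scope.

(* Packing R[i] as a numClosedFieldType lets it inherit the topology and the
   normed-module structure over itself given by its norm; the bare type R[i]
   has no such instances. *)
Definition Complex (R : realType) : numClosedFieldType := R[i]%C.

Section Germs.
Variables (R : realType) (n : nat).
Local Notation C := (Complex R).
Local Notation Cn := 'rV[C]_n.

(* [differentiable] is Fréchet differentiability over the scalar field of the
   normed modules, here C, hence complex differentiability. *)
Definition holomorphic_near0 : {pred Cn -> C} :=
  fun f => `[< \forall z \near (0 : Cn), differentiable f z >].

Lemma holomorphic_near0P (f : Cn -> C) :
  reflect (\forall z \near (0 : Cn), differentiable f z)
          (f \in holomorphic_near0).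
Proof. exact: asboolP. Qed.

Fact holomorphic_near0_subring : subring_closed holomorphic_near0.
Proof.
have F := nbhs_filter (0 : Cn).
split=> [|f g /holomorphic_near0P hf /holomorphic_near0P hg
         |f g /holomorphic_near0P hf /holomorphic_near0P hg];
  apply/holomorphic_near0P.
- by apply: (filterE F) => z; exact: differentiable_cst.
- by apply: (@filterS2 _ _ F) hf hg => z; exact: differentiableB.
- by apply: (@filterS2 _ _ F) hf hg => z; exact: differentiableM.
Qed.

HB.instance Definition _ := GRing.isSubringClosed.Build (Cn -> C)
  holomorphic_near0 holomorphic_near0_subring.

Record holo := Holo {
  holo_fun :> Cn -> C;
  holo_funP : holo_fun \in holomorphic_near0
}.

HB.instance Definition _ := [isSub for holo_fun].
HB.instance Definition _ := [Choice of holo by <:].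
HB.instance Definition _ := [SubChoice_isSubComNzRing of holo by <:].

Definition null_near0 : {pred holo} :=
  fun f => `[< \forall z \near (0 : Cn), f z = 0 >].

Lemma null_near0P (f : holo) :
  reflect (\forall z \near (0 : Cn), f z = 0) (f \in null_near0).
Proof. exact: asboolP. Qed.

Fact null_near0_idealr : idealr_closed null_near0.
Proof.
have F := nbhs_filter (0 : Cn).
split.
- by apply/null_near0P; apply: (filterE F).
- apply/null_near0P => /nbhs_singleton/eqP.
  by rewrite (_ : (1 : holo) 0 = 1) ?oner_eq0.
- move=> a f g /null_near0P hf /null_near0P hg; apply/null_near0P.
  apply: (@filterS2 _ _ F) hf hg => z fz gz.
  by rewrite (_ : (a * f + g) z = a z * f z + g z) // fz gz mulr0 addr0.
Qed.

HB.instance Definition _ := isIdealr.Build holo null_near0 null_near0_idealr.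

(* The ring O_n of germs at 0 of holomorphic functions on C^n: two functions
   holomorphic near 0 have the same germ iff they agree near 0. *)
Definition germ := {ideal_quot null_near0}.
HB.instance Definition _ := GRing.ComNzRing.on germ.
HB.instance Definition _ := EqQuotient.on germ.

Lemma germ_eqP (f g : holo) :
  (\pi_germ f = \pi_germ g) <-> (\forall z \near (0 : Cn), f z = g z).
Proof.
have F := nbhs_filter (0 : Cn).
split=> [/eqP|fg].
  rewrite -[_ == _]/(f == g %[mod germ]) -Quotient.idealrBE.
  move=> /null_near0P; apply: filterS => z.
  by rewrite (_ : (f - g) z = f z - g z) // => /subr0_eq.
apply/eqP; rewrite -Quotient.idealrBE; apply/null_near0P.
by apply: filterS fg => z; rewrite (_ : (f - g) z = f z - g z) // => ->; rewrite subrr.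
Qed.

(* Independent of the representative, by [germ_eval0E]. *)
Definition germ_eval0 (x : germ) : C := (repr x : holo) 0.

Lemma germ_eval0E (f : holo) : germ_eval0 (\pi_germ f) = f 0.
Proof.
have /germ_eqP/nbhs_singleton : \pi_germ (repr (\pi_germ f)) = \pi_germ f.
  exact: reprK.
by [].
Qed.

End Germs.

(* The ideal (g_1, ..., g_p). *)
Definition ideal_gen (A : comNzRingType) (p : nat) (g : 'I_p -> A) : set A :=
  [set x | exists a : 'I_p -> A, x = \sum_(i < p) a i * g i].

(* Main.v *)
From HB Require Import structures.
Require Import Defs.
From mathcomp Require Import all_boot all_order all_algebra.
From mathcomp Require Import all_classical all_reals all_analysis.
From mathcomp Require Import ring_quotient ring.

Set Implicit Arguments.
Unset Strict Implicit.
Unset Printing Implicit Defensive.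

Import Order.TTheory GRing.Theory Num.Theory numFieldNormedType.Exports.
Local Open Scope classical_set_scope.
Local Open Scope ring_scope.

(** A nondegenerate symmetric matrix H over the ring of germs is congruent to
    the identity: H = P^T P with P invertible.  Then g' = P g generates the
    same ideal as g, and f = g^T H g = (P g)^T (P g) is the sum of the squares
    of the g'_i.

    The factorization is the diagonalization of quadratic forms, which works
    as over an algebraically closed field because every germ with nonzero
    value at 0 is invertible and has a square root ([germ_unit_sqrt]).  One
    finds a vector on which the form takes a unit value
    ([exists_unit_pivot]), moves this value to the top left corner of H by a
    transvection, splits it off using its square root
    ([symmetric_factor_pivot]), and recurses on the Schur complement
    ([symmetric_factor]).  Germs enter this algebra only through the
    evaluation morphism at 0 and the square roots.

    The square root of a germ is its composition with a branch of the square
    root near its nonzero value; [differentiable_sqrt_branch] builds such a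
    branch by choosing, of the two roots of w, the one closer to a fixed root
    of the center. *)

(** * Symmetric matrices over a ring whose units are squares *)

Section SymmetricFactorization.
Variables (A : comNzRingType) (K : fieldType) (ev : {rmorphism A -> K}).
Hypothesis two_neq0 : 2%:R != 0 :> K.
Hypothesis unit_sqrt :
  forall x, ev x != 0 -> exists s t, s ^+ 2 = x /\ s * t = 1.

(** The value of the form a + 2 b c + c^T D c is the top left entry of the
    matrix after the transvection of parameter c.  If a is not a unit, then
    nondegeneracy gives a unit b_j, and by polarization one of the vectors
    e_0 + e_j, e_0 - e_j has a unit value. *)
Lemma exists_unit_pivot p (a : 'M[A]_1) (b : 'rV[A]_p) (D : 'M[A]_p) :
  \det (map_mx ev (block_mx a b b^T D)) != 0 ->
  exists c : 'cV[A]_p, ev ((a + b *m c + (b *m c)^T + c^T *m D *m c) 0 0) != 0.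
Proof.
move=> detH.
have [a0|] := eqVneq (ev (a 0 0)) 0; last first.
  by move=> ?; exists 0; rewrite !(mulmx0, trmx0, addr0).
have [j bj] : exists j, ev (b 0 j) != 0.
  apply/existsP; apply: contraNT detH => /existsPn b0.
  have a0' : map_mx ev a = 0 by apply/matrixP=> i k; rewrite !ord1 !mxE.
  have b0' : map_mx ev b = 0.
    by apply/matrixP=> i k; rewrite !ord1 !mxE; apply/eqP;
      rewrite -[_ == _]negbK b0.
  by rewrite map_block_mx a0' b0' det_lblock det_mx11 mxE mul0r.
pose v t : 'cV[A]_p := t *: delta_mx j 0.
have vE t : ev ((a + b *m v t + (b *m v t)^T + (v t)^T *m D *m v t) 0 0) =
    2%:R * ev t * ev (b 0 j) + ev t ^+ 2 * ev (D j j).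
  have bE : (b *m v t) 0 0 = t * b 0 j by rewrite -scalemxAr -colE !mxE.
  have DE : ((v t)^T *m D *m v t) 0 0 = t * (t * D j j).
    rewrite -scalemxAr -colE linearZ /= trmx_delta -scalemxAl -rowE.
    by rewrite !mxE.
  rewrite 3![(_ + _ : 'M[A]_1) _ _]mxE [(_ ^T) _ _]mxE bE DE.
  by rewrite !(rmorphD, rmorphM) a0 add0r; ring.
(* If both e_0 + e_j and e_0 - e_j were isotropic, their values would differ
   by 4 ev (b 0 j) = 0. *)
have [v1|] := eqVneq
  (ev ((a + b *m v 1 + (b *m v 1)^T + (v 1)^T *m D *m v 1) 0 0)) 0; last first.
  by exists (v 1).
exists (v (-1)); apply: contraNneq bj; rewrite vE rmorphN rmorph1.
move: v1; rewrite vE rmorph1 => v1 v2.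
have : 2%:R * 2%:R * ev (b 0 j) = 0.
  by rewrite -[RHS](subrr 0) -{1}v1 -v2; ring.
by move/eqP; rewrite !mulf_eq0 !(negbTE two_neq0).
Qed.

(** Completing the square: if a = s^2 with inverse t^2, and if the Schur
    complement S = D - t^2 b^T b is P^T P, then the matrix is L^T L for L with
    rows (s, t b) and (0, P).  The block triangular decomposition of the matrix
    shows that its determinant is a times that of S, so S is nondegenerate. *)
Lemma symmetric_factor_pivot p (a : 'M[A]_1) (b : 'rV[A]_p) (D : 'M[A]_p) :
  (forall S : 'M[A]_p, S^T = S -> \det (map_mx ev S) != 0 ->
     exists P : 'M[A]_p, S = P^T *m P) ->
  D^T = D -> ev (a 0 0) != 0 -> \det (map_mx ev (block_mx a b b^T D)) != 0 ->
  exists P : 'M[A]_(1 + p), block_mx a b b^T D = P^T *m P.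
Proof.
move=> IH symD a_unit; have [s [t [ssq st]]] := unit_sqrt a_unit.
have aE : a = (s ^+ 2)%:M by rewrite ssq -mx11_scalar.
pose S := D - (t *: b)^T *m (t *: b).
have uT : (t *: b)^T = t *: b^T by rewrite linearZ.
have HE : block_mx a b b^T D =
    block_mx (1%:M : 'M[A]_1) (0 : 'rV[A]_p) ((t ^+ 2) *: b^T) (1%:M : 'M[A]_p)
      *m block_mx a b (0 : 'cV[A]_p) S.
  rewrite mulmx_block !mul1mx !mul0mx !addr0 aE mul_mx_scalar scalerA.
  congr block_mx.
    by rewrite -exprMn st expr1n scale1r.
  by rewrite /S uT -!scalemxAl -scalemxAr scalerA expr2 addrC subrK.
rewrite {1}HE map_mxM !map_block_mx !map_mx0 !map_mx1.
rewrite det_mulmx det_lblock det_ublock !det1 !mul1r mulf_eq0 negb_or.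
case/andP=> _ detS.
have [P SE] : exists P : 'M[A]_p, S = P^T *m P.
  by apply: IH detS; rewrite /S linearB /= trmx_mul trmxK symD.
exists (block_mx s%:M (t *: b) 0 P).
rewrite tr_block_mx mulmx_block tr_scalar_mx trmx0 !mulmx0 !mul0mx !addr0.
rewrite -SE /S -scalar_mxM -expr2 -aE mul_scalar_mx scalerA st scale1r.
by rewrite mul_mx_scalar uT scalerA st scale1r addrC subrK.
Qed.

(** The transvection M creates a unit pivot; N is its inverse, which carries
    the factorization of M^T H M back to H. *)
Lemma symmetric_factor p (H : 'M[A]_p) :
  H^T = H -> \det (map_mx ev H) != 0 -> exists P : 'M[A]_p, H = P^T *m P.
Proof.
elim: p H => [|p IH]; first by move=> H _ _; exists 1%:M; apply/matrixP => - [].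
rewrite -[p.+1]add1n => H symH detH.
have [c c_unit] : exists c : 'cV[A]_p,
    let M : 'M[A]_(1 + p) := block_mx 1%:M 0 c 1%:M in
    ev (ulsubmx (M^T *m H *m M) 0 0) != 0.
  have := symH; have := detH; rewrite -[H](@submxK _ 1 p 1 p).
  move: (ulsubmx _) (ursubmx _) (dlsubmx _) (drsubmx _) => a b b' D {}detH.
  rewrite tr_block_mx => /eq_block_mx [_ _ bT _].
  move: detH; rewrite -bT => detH.
  have [c c_unit] := exists_unit_pivot detH; exists c => /=.
  rewrite tr_block_mx !mulmx_block block_mxKul !trmx1 !mul1mx !mulmx1.
  move: c_unit; rewrite mulmxDl trmx_mul !addrA => c_unit.
  by rewrite [a + _ + b *m c]addrAC.
pose M : 'M[A]_(1 + p) := block_mx 1%:M 0 c 1%:M.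
pose N : 'M[A]_(1 + p) := block_mx 1%:M 0 (- c) 1%:M.
have MN : M *m N = 1%:M.
  rewrite mulmx_block !mul1mx !mulmx1 !mulmx0 !mul0mx !addr0 add0r subrr.
  by rewrite -scalar_mx_block.
pose H' := M^T *m H *m M.
have symH' : H'^T = H' by rewrite !trmx_mul trmxK symH mulmxA.
have detH' : \det (map_mx ev H') != 0.
  rewrite !map_mxM -map_trmx !det_mulmx det_tr map_block_mx map_mx0 !map_mx1.
  by rewrite det_lblock !det1 !mul1r mulr1.
have HE : H = N^T *m H' *m N.
  by rewrite /H' !mulmxA -trmx_mul MN trmx1 mul1mx -mulmxA MN mulmx1.
have : exists P : 'M[A]_(1 + p), H' = P^T *m P.
  move: symH' detH' c_unit; rewrite /= -/M -/H' -[H' in H'^T](submxK H').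
  rewrite -[H' in RHS](submxK H') -[H' in map_mx _ H'](submxK H').
  rewrite -[X in exists _, X = _](submxK H') => + detH' c_unit.
  rewrite tr_block_mx => /eq_block_mx [_ _ bT symD].
  by move: detH'; rewrite -bT => detH'; apply: symmetric_factor_pivot.
move=> [P H'E]; exists (P *m N).
by rewrite [LHS]HE H'E trmx_mul !mulmxA.
Qed.
End SymmetricFactorization.

(** * Square roots and inverses of germs *)

(** Fix c with c^2 = a and let s w be the root of w that is closer to c.  From
    |s w - c| |s w + c| = |w - a| one gets |s w - c| < |c| / 2 near a, hence
    |s w + s w'| >= |c|.  The identity
    (s w' - s w) (s w' + s w) = w' - w then yields first the continuity of s,
    and next its derivative 1 / (2 s w). *)
Lemma differentiable_sqrt_branch (K : numClosedFieldType) (a : K) : a != 0 ->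
  exists s : K -> K, (forall w, s w ^+ 2 = w) /\
    \forall w \near a, differentiable s w.
Proof.
move=> a0; pose c := sqrtC a.
have c0 : 0 < `|c| by rewrite normr_gt0 sqrtC_eq0.
have c2 : c ^+ 2 = a by exact: sqrtCK.
pose s w := if `|sqrtC w - c| <= `|sqrtC w + c| then sqrtC w else - sqrtC w.
have s2 w : s w ^+ 2 = w by rewrite /s; case: ifP; rewrite ?sqrrN sqrtCK.
have sle w : `|s w - c| <= `|s w + c|.
  rewrite /s; case: ifPn => //; rewrite -real_ltNge ?normr_real// => /ltW.
  by rewrite -opprD normrN [- _ + _]addrC distrC.
exists s; split=> //.
have s_near w : `|a - w| < (`|c| / 2) ^+ 2 -> `|s w - c| < `|c| / 2.
  rewrite -c2 -{1}[w]s2 distrC subr_sqr normrM => lt.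
  rewrite -(ltr_pXn2r (n := 2)) ?nnegrE ?divr_ge0//.
  by apply: le_lt_trans lt; rewrite expr2 ler_wpM2l.
have sum_ge w w' : `|a - w| < (`|c| / 2) ^+ 2 -> `|a - w'| < (`|c| / 2) ^+ 2 ->
    `|c| <= `|s w + s w'|.
  move=> /s_near lw /s_near lw'.
  have -> : s w + s w' = c *+ 2 - ((c - s w) + (c - s w')).
    by rewrite mulr2n opprD !opprB addrACA ![c + _]addrC !subrK.
  apply: le_trans (lerB_dist _ _).
  rewrite normrMn lerBrDr mulr2n lerD2l.
  apply: le_trans (ler_normD _ _) _; rewrite ![`|c - _|]distrC.
  by rewrite [leRHS]splitr lerD// ltW.
have near_a w : `|a - w| < (`|c| / 2) ^+ 2 ->
    \forall w' \near w, `|a - w'| < (`|c| / 2) ^+ 2.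
  by move=> lt; apply: open_nbhs_nbhs; split=> //; exact: ball_open.
have e0 : 0 < (`|c| / 2) ^+ 2 by rewrite exprn_gt0// divr_gt0.
suff: forall w, `|a - w| < (`|c| / 2) ^+ 2 -> differentiable s w.
  by move=> H; near=> w; apply: H; near: w; exact: (cvgr_dist_lt _ a).
move=> w lw; apply/derivable1_diffP.
have scont : s w' @[w' --> w] --> s w.
  apply/(@cvgrPdist_le _ K _ _ (nbhs_filter w)) => e egt0; near=> w'.
  have lw' : `|a - w'| < (`|c| / 2) ^+ 2 by near: w'; exact: near_a.
  have cs := sum_ge _ _ lw lw'.
  rewrite -(ler_pM2r (lt_le_trans c0 cs)) -normrM -subr_sqr !s2.
  apply: (@le_trans _ _ (e * `|c|)); last by rewrite ler_pM2l.
  near: w'; apply: (cvgr_dist_le _ w) => //; exact: mulr_gt0.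
have sw0 : s w + s w != 0.
  by rewrite -normr_gt0 (lt_le_trans c0)// sum_ge.
apply/cvg_ex; exists ((s w + s w)^-1).
have F0 : Filter (0 : K)^' by exact: dnbhs_filter.
have shift_cvg : h + w @[h --> (0 : K)^'] --> w.
  rewrite -[X in _ --> X]add0r; apply: cvgD; last exact: cvg_cst.
  exact: cvg_within.
have inv_cvg : (s (h + w) + s w)^-1 @[h --> (0 : K)^'] --> (s w + s w)^-1.
  apply: cvgV => //; apply: cvgD; last exact: cvg_cst.
  exact: cvg_comp shift_cvg scont.
apply: cvg_trans inv_cvg; apply: near_eq_cvg; near=> h.
have lhw : `|a - (h + w)| < (`|c| / 2) ^+ 2.
  by near: h; apply: (shift_cvg _ (near_a w lw)).
have h0 : h != 0 by near: h; exact: nbhs_dnbhs_neq.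
have sum0 : s (h + w) + s w != 0.
  by rewrite -normr_gt0 (lt_le_trans c0)// sum_ge.
rewrite /= [h *: 1]mulr1.
have hE : h = (s (h + w) - s w) * (s (h + w) + s w).
  by rewrite -subr_sqr !s2 addrK.
rewrite {2}hE -[RHS]/(_ * _) invfM.
apply: (mulIf sum0); rewrite mulVf//.
have d0 : s (h + w) - s w != 0.
  by apply: contraNneq h0 => d0; rewrite hE d0 mul0r.
by rewrite mulrAC mulfVK// mulVf.
Unshelve. all: by end_near.
Qed.

Section GermRing.
Variables (R : realType) (n : nat).
Local Notation C := (Complex R).
Local Notation O := (germ R n).
Local Open Scope quotient_scope.

Fact germ_eval0_zmod_morphism : zmod_morphism (@germ_eval0 R n).
Proof. by move=> x y; rewrite -[x]reprK -[y]reprK -rmorphB !germ_eval0E. Qed.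

Fact germ_eval0_monoid_morphism : monoid_morphism (@germ_eval0 R n).
Proof.
split=> [|x y]; first by rewrite -(rmorph1 \pi_O) germ_eval0E.
by rewrite -[x]reprK -[y]reprK -rmorphM !germ_eval0E.
Qed.

HB.instance Definition _ := GRing.isZmodMorphism.Build O C (@germ_eval0 R n)
  germ_eval0_zmod_morphism.
HB.instance Definition _ := GRing.isMonoidMorphism.Build O C (@germ_eval0 R n)
  germ_eval0_monoid_morphism.

Lemma holo_continuous0 (f : holo R n) : {for 0, continuous f}.
Proof.
have /holomorphic_near0P df := holo_funP f.
by apply: differentiable_continuous; exact: nbhs_singleton df.
Qed.

Lemma holo_comp (phi : C -> C) (f : holo R n) :
  (\forall w \near f 0, differentiable phi w) ->
  exists g : holo R n, forall z, g z = phi (f z).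
Proof.
move=> dphi.
have dphif : \forall z \near (0 : 'rV[C]_n), differentiable phi (f z).
  exact: (holo_continuous0 dphi).
have /holomorphic_near0P df := holo_funP f.
have F := nbhs_filter (0 : 'rV[C]_n).
have dcomp : \forall z \near (0 : 'rV[C]_n), differentiable (phi \o f) z.
  apply: (@filterS2 _ _ F) df dphif => z dfz dphiz.
  exact: differentiable_comp.
suff gP : phi \o f \in @holomorphic_near0 R n by exists (Holo gP).
exact/holomorphic_near0P.
Qed.

(** The inverse t of the root is what completing the square divides by, and
    t^2 is the inverse of x. *)
Lemma germ_unit_sqrt (x : O) : germ_eval0 x != 0 ->
  exists s t : O, s ^+ 2 = x /\ s * t = 1.
Proof.
move=> x0; pose f : holo R n := repr x.
have f0 : f 0 != 0 by [].
have [sq [sq2 dsq]] := differentiable_sqrt_branch f0.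
have [s sE] := holo_comp dsq.
have s0 : s 0 != 0 by rewrite sE -sqrf_eq0 sq2.
have [|t tE] := @holo_comp GRing.inv s.
  have : \forall w \near s 0, w != 0.
    by apply: (@cvgr_neq0 C C C (nbhs (s 0)) _ id (s 0)) => //; exact: cvg_id.
  by apply: filterS => w w0; apply/derivable1_diffP; exact: derivableV.
have F := nbhs_filter (0 : 'rV[C]_n).
exists (\pi s), (\pi t); split.
  rewrite -[x]reprK -rmorphXn; apply/germ_eqP; apply: (filterE F) => z.
  by rewrite -[RHS]sq2 -sE.
rewrite -rmorphM -(rmorph1 \pi_O); apply/germ_eqP.
have sn0 : \forall z \near (0 : 'rV[C]_n), s z != 0.
  by apply: (@cvgr_neq0 C C _ _ F s (s 0)) s0; exact: holo_continuous0.
apply: (@filterS _ _ F) sn0 => z sz0.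
by rewrite -[LHS]/(s z * t z) tE divff.
Qed.

End GermRing.

(** * Linear changes of generators *)

Lemma ideal_gen_mulmx (A : comNzRingType) p (g : 'I_p -> A) (P : 'M[A]_p) x :
  ideal_gen (fun i => \sum_(j < p) P i j * g j) x -> ideal_gen g x.
Proof.
case=> a ->; exists (fun j => \sum_(i < p) a i * P i j).
under eq_bigr do rewrite mulr_sumr; rewrite exchange_big /=.
apply: eq_bigr => j _; rewrite mulr_suml.
by apply: eq_bigr => i _; rewrite mulrA.
Qed.

Lemma ideal_gen_invertible (A : comNzRingType) p (g : 'I_p -> A)
    (P Q : 'M[A]_p) : Q *m P = 1%:M ->
  ideal_gen g = ideal_gen (fun i => \sum_(j < p) P i j * g j).
Proof.
move=> QP; apply/seteqP; split=> x; last exact: ideal_gen_mulmx.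
have {1}-> : g = fun i => \sum_(j < p) Q i j * \sum_(k < p) P j k * g k.
  apply/funext => i; transitivity (\sum_(k < p) (Q *m P) i k * g k).
    rewrite QP (bigD1 i) //= mxE eqxx mul1r big1 ?addr0// => k ki.
    by rewrite mxE eq_sym (negbTE ki) mul0r.
  under [RHS]eq_bigr do rewrite mulr_sumr; rewrite exchange_big /=.
  apply: eq_bigr => k _; rewrite mxE mulr_suml.
  by apply: eq_bigr => j _; rewrite mulrA.
exact: ideal_gen_mulmx.
Qed.

Lemma sum_sqr_mulmx (A : comNzRingType) p (g : 'I_p -> A) (P : 'M[A]_p) :
  \sum_(i < p) (\sum_(j < p) P i j * g j) ^+ 2 =
  \sum_(i < p) \sum_(j < p) (P^T *m P) i j * g i * g j.
Proof.
transitivity (\sum_(k < p) \sum_(i < p) \sum_(j < p)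
    P k i * g i * (P k j * g j)).
  by apply: eq_bigr => k _; rewrite expr2 big_distrlr.
rewrite exchange_big; apply: eq_bigr => i _; rewrite exchange_big.
apply: eq_bigr => j _; rewrite mxE -mulrA mulr_suml.
by apply: eq_bigr => k _; rewrite mxE mulrACA.
Qed.

Theorem mainTheorem13 (R : realType) (n p : nat) (I : set (germ R n))
    (g : 'I_p -> germ R n) (f : germ R n) (h : 'M[germ R n]_p)
    (hI : I = ideal_gen g)
    (hf : f = \sum_(i < p) \sum_(j < p) h i j * g i * g j)
    (hsym : forall i j : 'I_p, h i j = h j i)
    (hdet : \det (map_mx (@germ_eval0 R n) h) != 0) :
  exists g' : 'I_p -> germ R n,
    I = ideal_gen g' /\ f = \sum_(i < p) g' i ^+ 2.
Proof.
have two_neq0 : 2%:R != 0 :> Complex R by rewrite pnatr_eq0.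
have symh : h^T = h by apply/matrixP=> i j; rewrite mxE.
have [P hE] := symmetric_factor two_neq0 (@germ_unit_sqrt R n) symh hdet.
(* det H = (det P)^2, so det P does not vanish at 0; as det P = s^2 and s t = 1,
   the inverse of P is t^2 times its adjugate. *)
have [Q QP] : exists Q, Q *m P = 1%:M.
  have : germ_eval0 (\det P) != 0.
    apply: contraNneq hdet => P0.
    by rewrite det_map_mx hE det_mulmx rmorphM /= P0 mulr0.
  case/germ_unit_sqrt=> s [t [s2 st]]; exists (t ^+ 2 *: \adj P).
  by rewrite -scalemxAl mul_adj_mx scale_scalar_mx -s2 -exprMn mulrC st expr1n.
exists (fun i => \sum_(j < p) P i j * g j); split.
  by rewrite hI; exact: ideal_gen_invertible QP.
by rewrite hf sum_sqr_mulmx -hE.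
Qed.
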